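(* Let $\mu\in\mathbb{C}\setminus\{0\}$ and $\lambda\in\mathbb{C}$ with $\Re\lambda>0$. The function $\beta_{\lambda,\mu}$ satisfies the asymptotic equation $$\frac{\ln\beta_{\lambda,\mu}(s+1)}{\mu}=\beta_{\lambda,\mu}(s)+\mathcal{O}(e^{-\lambda s})\quad\text{as } |s|\to\infty \text{ while } |\arg(\lambda s)|<\pi/2.$$
   Context: For $j\ge 1$ let $q_j(s,z)=\dfrac{e^{\mu z}}{1+e^{\lambda(j-s)}}$, and let $\beta_{\lambda,\mu}(s)=\lim_{n\to\infty}q_1(s,q_2(s,\dots q_n(s,z)\dots))$ (nested in $z$; the limit does not depend on $z\in\mathbb{C}$). It is holomorphic for $s$ with $\lambda(j-s)\ne(2k+1)\pi i$ for all integers $j\ge1$, $k$, and satisfies $\beta_{\lambda,\mu}(s+1)=e^{\mu\beta_{\lambda,\mu}(s)}/(1+e^{-\lambda s})$. The value of the logarithm is the one for which $\ln\beta_{\lambda,\mu}(s+1)=\mu\beta_{\lambda,\mu}(s)-\ln(1+e^{-\lambda s})$, with $\ln(1+x)$ the branch that vanishes at $x=0$. *)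

(* Defs.v *)
(* Stdlib reals with Coquelicot's complex numbers. *)
From Stdlib Require Import Reals.
From Coquelicot Require Import Coquelicot.

Open Scope C_scope.

Definition Cexp (z : C) : C := (exp (Re z) * cos (Im z), exp (Re z) * sin (Im z))%R.

(* Principal argument, with values in (-PI, PI]; the junk value at 0 is PI / 2. *)
Definition Carg (z : C) : R :=
  if Rlt_dec (Im z) 0 then (- acos (Re z / Cmod z))%R else acos (Re z / Cmod z).

(* Principal branch; on the disc |x| < 1, [Cln (1 + x)] is the branch of
   ln (1 + x) that vanishes at x = 0. *)
Definition Cln (z : C) : C := (ln (Cmod z), Carg z).

Definition q (lambda mu : C) (j : nat) (s z : C) : C :=
  Cexp (mu * z) / (1 + Cexp (lambda * (INR j - s))).

(* [q_nest lambda mu s n z] is q_1(s, q_2(s, ... q_n(s, z) ...)): the innermost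
   map, the one applied first, has the largest index. *)
Fixpoint q_nest (lambda mu s : C) (n : nat) (z : C) : C :=
  match n with
  | O => z
  | S m => q_nest lambda mu s m (q lambda mu (S m) s z)
  end.

(* The common limit of the nested maps for all starting points z; [iota] returns
   an unspecified value where there is no such (unique) limit. *)
Definition beta (lambda mu s : C) : C :=
  iota (T := C_CompleteNormedModule)
    (fun b : C => forall z : C,
       filterlim (fun n => q_nest lambda mu s n z) eventually (locally b)).

Definition beta_dom (lambda s : C) : Prop :=
  forall (j : nat) (k : Z), (1 <= j)%nat ->
    lambda * (INR j - s) <> (2 * IZR k + 1) * PI * Ci.

(* The value of ln (beta (s + 1)): a logarithm of beta (s + 1), on the branch
   singled out by the functional equation of beta. *)
Definition is_ln_beta_succ (lambda mu s w : C) : Prop :=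
  Cexp w = beta lambda mu (s + 1) /\
  w = mu * beta lambda mu s - Cln (1 + Cexp (- (lambda * s))).

(* The filter |s| -> infinity in the complex plane. *)
Definition C_infty (P : C -> Prop) : Prop :=
  exists M : R, forall s : C, (M < Cmod s)%R -> P s.

Definition is_bigO (F : (C -> Prop) -> Prop) (f g : C -> C) : Prop :=
  exists K : R, F (fun s => (Cmod (f s) <= K * Cmod (g s))%R).

(* Main.v *)
Require Import Defs.
From Stdlib Require Import Reals.
From Coquelicot Require Import Coquelicot.
From Stdlib Require Import Lra Lia.

(** The logarithm in question is
    [mu * beta s - ln (1 + exp (- lambda s))], so the asymptotic equation is the
    elementary estimate [ln (1 + x) = O(x)] at [x = exp (- lambda s)] divided by
    [mu]. In a sector [|arg (lambda s)| <= theta < PI / 2] one has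
    [Re (lambda s) >= |lambda s| cos theta], so that [x] tends to [0] there as
    [|s|] grows, and the principal branch is controlled by [Cmod_Cln_1_plus].

    That this value is a logarithm of [beta (s + 1)] is the functional equation
    [beta (s + 1) = exp (mu * beta s) / (1 + exp (- lambda s))] ([beta_succ]).
    It comes from [q_{j+1} (s + 1, z) = q_j (s, z)]: the nested maps at [s + 1]
    are the map [q_1 (s + 1, .)] applied to the nested maps at [s], and a
    continuous map passes to the limit.

    The substance is thus the existence of the limit defining [beta]
    ([ex_nest_limit]). The denominators [1 + exp (lambda (j - s))] grow
    exponentially in [j], and also when [s] moves to the left. So for a large
    integer [N], at [s - N] every [q_j] maps the closed unit disc into itself
    and contracts it by a factor [1 / 2], while every fixed [z] is sent into the
    disc by all but finitely many [q_j]. The nested maps are therefore a Cauchy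
    sequence whose limit does not depend on [z] ([contraction_nest_limit]).
    Applying the shift [N] times brings the limit back from [s - N] to [s]. *)

Local Open Scope C_scope.

(** * The complex exponential *)

Lemma Cexp_plus (a b : C) : Cexp (a + b) = Cexp a * Cexp b.
Proof.
  destruct a as [a1 a2], b as [b1 b2].
  unfold Cexp, Cmult, Cplus; simpl.
  rewrite exp_plus, cos_plus, sin_plus.
  f_equal; ring.
Qed.

Lemma Cexp_0 : Cexp 0 = 1.
Proof.
  unfold Cexp; simpl. rewrite exp_0, cos_0, sin_0.
  unfold RtoC; f_equal; ring.
Qed.

Lemma Cexp_neq_0 (z : C) : Cexp z <> 0.
Proof.
  intros Hz. apply C1_nz.
  replace (RtoC 1) with (Cexp z * Cexp (- z)).
  - rewrite Hz. ring.
  - rewrite <- Cexp_plus, Cplus_opp_r. exact Cexp_0.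
Qed.

Lemma Cexp_minus (a b : C) : Cexp (a - b) = Cexp a / Cexp b.
Proof.
  assert (H : Cexp a = Cexp (a - b) * Cexp b)
    by (rewrite <- Cexp_plus; f_equal; ring).
  rewrite H. field. apply Cexp_neq_0.
Qed.

Lemma Cmod_Cexp (z : C) : Cmod (Cexp z) = exp (Re z).
Proof.
  unfold Cmod, Cexp; cbn [fst snd].
  replace ((exp (Re z) * cos (Im z)) ^ 2 + (exp (Re z) * sin (Im z)) ^ 2)%R
    with ((exp (Re z))²).
  - apply sqrt_Rsqr, Rlt_le, exp_pos.
  - generalize (sin2_cos2 (Im z)); unfold Rsqr; intros H.
    transitivity ((exp (Re z) * exp (Re z)) *
                  (sin (Im z) * sin (Im z) + cos (Im z) * cos (Im z)))%R;
      [rewrite H|]; ring.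
Qed.

Lemma Im_le_Cmod (z : C) : (Rabs (Im z) <= Cmod z)%R.
Proof. exact (Rle_trans _ _ _ (Rmax_r _ _) (Rmax_Cmod z)). Qed.

Lemma exp_le_exp (x y : R) : (x <= y)%R -> (exp x <= exp y)%R.
Proof. intros [H| ->]; [left; now apply exp_increasing|right; reflexivity]. Qed.

Lemma exp_minus_1_bound (x : R) : (Rabs (exp x - 1) <= Rabs x * exp (Rabs x))%R.
Proof.
  destruct (Rle_lt_dec 0 x) as [Hx|Hx].
  - rewrite (Rabs_pos_eq x Hx).
    assert (H1 := exp_ineq1_le x). assert (H2 := exp_ineq1_le (- x)).
    assert (H3 : (exp x * exp (- x) = 1)%R).
    { rewrite <- exp_plus, Rplus_opp_r. exact exp_0. }
    assert (H4 := exp_pos x).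
    rewrite Rabs_pos_eq; nra.
  - rewrite (Rabs_left x Hx).
    assert (H1 := exp_ineq1_le x). assert (H2 := exp_ineq1_le (- x)).
    assert (H3 : (exp x <= exp 0)%R) by (apply exp_le_exp; lra).
    rewrite exp_0 in H3.
    rewrite Rabs_left1; nra.
Qed.

Lemma Rabs_sin_le (x : R) : (Rabs (sin x) <= Rabs x)%R.
Proof.
  assert (Hpos : forall y, (0 <= y)%R -> (Rabs (sin y) <= y)%R).
  { intros y [Hy| <-]; [|rewrite sin_0, Rabs_R0; lra].
    assert (H1 := sin_lt_x y Hy). assert (H2 := SIN_bound y).
    unfold Rabs; destruct (Rcase_abs (sin y)) as [Hs|Hs]; [|lra].
    destruct (Rle_lt_dec PI y) as [HPI|HPI].
    - generalize PI2_1; lra.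
    - assert (H3 := sin_gt_0 y Hy HPI); lra. }
  destruct (Rle_lt_dec 0 x) as [Hx|Hx].
  - rewrite (Rabs_pos_eq x Hx); auto.
  - rewrite <- (Rabs_Ropp (sin x)), <- sin_neg, (Rabs_left x Hx).
    apply Hpos; lra.
Qed.

(** The chord from [1] to the point of angle [y] on the unit circle has length
    [2 |sin (y / 2)|]. *)
Lemma Cmod_Cexp_imaginary_minus_1 (y : R) :
  (Cmod (Cexp (0, y)%R - 1) <= Rabs y)%R.
Proof.
  unfold Cmod, Cexp; cbn -[pow sqrt]. rewrite exp_0.
  replace ((1 * cos y + - (1)) ^ 2 + (1 * sin y + - 0) ^ 2)%R
    with ((2 * sin (y / 2))²).
  - rewrite sqrt_Rsqr_abs, Rabs_mult, (Rabs_pos_eq 2) by lra.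
    assert (H := Rabs_sin_le (y / 2)).
    unfold Rdiv in H at 2.
    rewrite Rabs_mult, (Rabs_pos_eq (/ 2)) in H by lra. lra.
  - assert (H := sin2_cos2 y). assert (H' := cos_2a_sin (y / 2)).
    replace (2 * (y / 2))%R with y in H' by field.
    unfold Rsqr in *. nra.
Qed.

(** For [z = x + i y], write [exp z - 1] as [exp x (exp (i y) - 1) + (exp x - 1)]:
    a chord of the circle plus a real increment. *)
Lemma Cmod_Cexp_minus_1 (z : C) :
  (Cmod (Cexp z - 1) <= 2 * Cmod z * exp (Cmod z))%R.
Proof.
  destruct z as [x y].
  set (w := ((x, y) : C)).
  assert (Hx : (Rabs x <= Cmod w)%R) by exact (re_le_Cmod w).
  assert (Hy : (Rabs y <= Cmod w)%R) by exact (Im_le_Cmod w).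
  replace (Cexp w - 1)
    with (Cexp (RtoC x) * (Cexp (0, y)%R - 1) + (Cexp (RtoC x) - 1)).
  2:{ replace w with (RtoC x + (0, y)%R).
      - rewrite Cexp_plus. ring.
      - unfold w, RtoC, Cplus; simpl; f_equal; ring. }
  eapply Rle_trans; [apply Cmod_triangle|].
  rewrite Cmod_mult, Cmod_Cexp.
  replace (Cexp (RtoC x) - 1) with (RtoC (exp x - 1)).
  2:{ unfold Cexp, RtoC, Cminus, Cplus, Copp; simpl.
      rewrite cos_0, sin_0; f_equal; ring. }
  rewrite Cmod_R.
  assert (H1 := Cmod_Cexp_imaginary_minus_1 y).
  assert (H2 := exp_minus_1_bound x).
  assert (H3 : (exp (Rabs x) <= exp (Cmod w))%R) by now apply exp_le_exp.
  assert (H4 : (exp x <= exp (Cmod w))%R)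
    by (apply exp_le_exp; generalize (Rle_abs x); lra).
  assert (H5 := exp_pos x). assert (H6 := exp_pos (Rabs x)).
  assert (H7 := Rabs_pos x). assert (H8 := Rabs_pos y).
  assert (H9 := Cmod_ge_0 (Cexp (0, y)%R - 1)).
  change (Re (RtoC x)) with x.
  assert (exp x * Cmod (Cexp (0, y)%R - 1) <= exp (Cmod w) * Cmod w)%R
    by (apply Rmult_le_compat; lra).
  assert (Rabs x * exp (Rabs x) <= Cmod w * exp (Cmod w))%R
    by (apply Rmult_le_compat; lra).
  lra.
Qed.

(** * The maps [q_j] *)

Lemma Cmod_minus_le (a b : C) : (Cmod a - Cmod b <= Cmod (a - b))%R.
Proof.
  assert (H := Cmod_triangle (a - b) b).
  replace (a - b + b) with a in H by ring. lra.
Qed.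

Lemma Re_le (z : C) : (Re z <= Cmod z)%R.
Proof. generalize (re_le_Cmod z) (Rle_abs (Re z)); lra. Qed.

(** [q_j] carries the factor [1 / (1 + exp (lambda (j - s)))], written as an
    inverse so that the bound also covers a vanishing denominator, where the
    inverse is [0]. *)
Lemma Cmod_q_le (lambda mu s z : C) (j : nat) (r : R) :
  (Cmod z <= r)%R ->
  (Cmod (q lambda mu j s z) <=
   exp (Cmod mu * r) * Cmod (/ (1 + Cexp (lambda * (INR j - s)))))%R.
Proof.
  intros Hz. unfold q, Cdiv. rewrite Cmod_mult, Cmod_Cexp.
  apply Rmult_le_compat_r; [apply Cmod_ge_0|].
  apply exp_le_exp. eapply Rle_trans; [apply Re_le|].
  rewrite Cmod_mult. apply Rmult_le_compat_l; [apply Cmod_ge_0|exact Hz].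
Qed.

(** Factor [exp (mu x) - exp (mu y)] as [exp (mu y) (exp (mu (x - y)) - 1)]; the
    first factor is at most [exp (|mu| r)], and [|x - y| <= 2 r] turns the bound
    on [exp w - 1] into a linear one. *)
Lemma q_lipschitz (lambda mu s x y : C) (j : nat) (r : R) :
  (Cmod x <= r)%R -> (Cmod y <= r)%R ->
  (Cmod (q lambda mu j s x - q lambda mu j s y) <=
   2 * Cmod mu * exp (3 * Cmod mu * r) *
   Cmod (/ (1 + Cexp (lambda * (INR j - s)))) * Cmod (x - y))%R.
Proof.
  intros Hx Hy. unfold q, Cdiv.
  set (d := / (1 + Cexp (lambda * (INR j - s)))).
  replace (Cexp (mu * x) * d - Cexp (mu * y) * d)
    with (Cexp (mu * y) * (Cexp (mu * (x - y)) - 1) * d).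
  2:{ replace (mu * x) with (mu * y + mu * (x - y)) by ring.
      rewrite Cexp_plus. ring. }
  rewrite !Cmod_mult, Cmod_Cexp.
  assert (Hm := Cmod_ge_0 mu). assert (Hd := Cmod_ge_0 d).
  assert (Hxy := Cmod_ge_0 (x - y)).
  assert (Hxyr : (Cmod (x - y) <= 2 * r)%R).
  { generalize (Cmod_triangle x (- y)). rewrite Cmod_opp. unfold Cminus. lra. }
  assert (H1 := Cmod_Cexp_minus_1 (mu * (x - y))).
  rewrite Cmod_mult in H1.
  assert (H2 : (exp (Re (mu * y)) <= exp (Cmod mu * r))%R).
  { apply exp_le_exp. eapply Rle_trans; [apply Re_le|].
    rewrite Cmod_mult. now apply Rmult_le_compat_l. }
  assert (H3 : (exp (Cmod mu * Cmod (x - y)) <= exp (2 * Cmod mu * r))%R).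
  { apply exp_le_exp. nra. }
  replace (exp (3 * Cmod mu * r))
    with (exp (Cmod mu * r) * exp (2 * Cmod mu * r))%R
    by (rewrite <- exp_plus; f_equal; ring).
  transitivity
    (exp (Cmod mu * r) *
     (2 * (Cmod mu * Cmod (x - y)) * exp (2 * Cmod mu * r)) * Cmod d)%R;
    [|right; ring].
  apply Rmult_le_compat_r; [exact Hd|].
  apply Rmult_le_compat; try apply Cmod_ge_0; [left; apply exp_pos|exact H2|].
  eapply Rle_trans; [exact H1|].
  apply Rmult_le_compat_l; [|exact H3].
  nra.
Qed.

(** Far to the right of [s] the denominators of the [q_j] grow like
    [exp (j Re lambda)]; this makes those [q_j] contractions. *)
Lemma q_denominator_large (lambda s : C) (hlambda : (0 < Re lambda)%R) (K : R) :
  exists N : nat, forall j : nat, (N <= j)%nat ->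
    (K <= Cmod (1 + Cexp (lambda * (INR j - s))))%R.
Proof.
  destruct (nfloor_ex (Rmax 0 ((K + Re (lambda * s)) / Re lambda)) (Rmax_l _ _))
    as [N [_ HN]].
  exists (S N). intros j Hj.
  apply le_INR in Hj. rewrite S_INR in Hj.
  assert (HM := Rmax_r 0 ((K + Re (lambda * s)) / Re lambda)).
  assert (H1 : ((K + Re (lambda * s)) / Re lambda <= INR j)%R) by lra.
  apply (Rmult_le_compat_r (Re lambda)) in H1; [|lra].
  unfold Rdiv in H1. rewrite Rmult_assoc, Rinv_l, Rmult_1_r in H1 by lra.
  assert (H2 := Cmod_minus_le (Cexp (lambda * (INR j - s))) (- (1))).
  rewrite Cmod_opp, Cmod_1, Cmod_Cexp in H2.
  replace (Cexp (lambda * (INR j - s)) - - (1))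
    with (1 + Cexp (lambda * (INR j - s))) in H2 by ring.
  assert (H3 := exp_ineq1_le (Re (lambda * (INR j - s)))).
  replace (Re (lambda * (INR j - s)))
    with (Re lambda * INR j - Re (lambda * s))%R in * by
    (destruct lambda, s; simpl; ring).
  lra.
Qed.

Lemma filterlim_C_iff (u : nat -> C) (b : C) :
  filterlim u eventually (locally b) <->
  (forall eps : R, (0 < eps)%R ->
     exists N : nat, forall n : nat, (N <= n)%nat -> (Cmod (u n - b) < eps)%R).
Proof.
  split.
  - intros H eps Heps.
    assert (Hs : (0 < sqrt 2)%R) by (apply sqrt_lt_R0; lra).
    assert (Heps' : (0 < eps / sqrt 2)%R) by now apply Rdiv_lt_0_compat.
    destruct (proj1 (filterlim_locally u b) H (mkposreal _ Heps')) as [N HN].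
    exists N. intros n Hn.
    eapply Rlt_le_trans; [exact (C_NormedModule_mixin_compat2 _ _ _ (HN n Hn))|].
    right. simpl. field. lra.
  - intros H. apply filterlim_locally. intros eps.
    destruct (H eps (cond_pos eps)) as [N HN].
    exists N. intros n Hn.
    apply C_NormedModule_mixin_compat1. exact (HN n Hn).
Qed.

(** Continuity of [q_j] in its second argument, by its Lipschitz bound on a disc
    about the origin that contains a neighbourhood of [b]. *)
Lemma q_filterlim (lambda mu s : C) (j : nat) (u : nat -> C) (b : C) :
  filterlim u eventually (locally b) ->
  filterlim (fun n => q lambda mu j s (u n)) eventually
    (locally (q lambda mu j s b)).
Proof.
  intros Hu. apply filterlim_C_iff. intros eps Heps.
  set (r := (Cmod b + 1)%R).
  set (L := (2 * Cmod mu * exp (3 * Cmod mu * r) *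
             Cmod (/ (1 + Cexp (lambda * (INR j - s)))))%R).
  assert (HL : (0 <= L)%R).
  { unfold L. apply Rmult_le_pos; [|apply Cmod_ge_0].
    apply Rmult_le_pos; [|left; apply exp_pos].
    generalize (Cmod_ge_0 mu); lra. }
  assert (Hd : (0 < Rmin 1 (eps / (L + 1)))%R).
  { apply Rmin_pos; [lra|]. apply Rdiv_lt_0_compat; lra. }
  destruct (proj1 (filterlim_C_iff u b) Hu _ Hd) as [N HN].
  exists N. intros n Hn. specialize (HN n Hn).
  assert (H1 := Rmin_l 1 (eps / (L + 1))).
  assert (H2 := Rmin_r 1 (eps / (L + 1))).
  assert (Hub := Cmod_minus_le (u n) b).
  assert (HLip : (Cmod (q lambda mu j s (u n) - q lambda mu j s b)
                  <= L * Cmod (u n - b))%R).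
  { apply q_lipschitz; unfold r; lra. }
  assert (H3 : ((L + 1) * (eps / (L + 1)) = eps)%R) by (field; lra).
  generalize (Cmod_ge_0 (u n - b)). nra.
Qed.

(** * Convergence of the nested maps *)

(** [q_j] depends on [j] and [s] only through [j - s]. *)
Lemma q_shift (lambda mu s z : C) (j : nat) :
  q lambda mu (S j) (s + 1) z = q lambda mu j s z.
Proof.
  unfold q. do 4 f_equal. rewrite S_INR, RtoC_plus. ring.
Qed.

Lemma q_nest_shift (lambda mu s : C) (n : nat) (z : C) :
  q_nest lambda mu (s + 1) (S n) z =
  q lambda mu 1 (s + 1) (q_nest lambda mu s n z).
Proof.
  revert z. induction n as [|n IH]; intros z; [reflexivity|].
  change (q_nest lambda mu (s + 1) (S n) (q lambda mu (S (S n)) (s + 1) z) =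
          q lambda mu 1 (s + 1) (q_nest lambda mu s n (q lambda mu (S n) s z))).
  now rewrite IH, (q_shift _ _ _ _ (S n)).
Qed.

(** The property that characterizes the value [beta lambda mu s]. *)
Definition is_nest_limit (lambda mu s b : C) : Prop :=
  forall z : C, filterlim (fun n => q_nest lambda mu s n z) eventually (locally b).

Lemma is_nest_limit_succ (lambda mu s b : C) :
  is_nest_limit lambda mu s b ->
  is_nest_limit lambda mu (s + 1) (q lambda mu 1 (s + 1) b).
Proof.
  intros Hb z.
  assert (H := q_filterlim lambda mu (s + 1) 1 _ b (Hb z)).
  apply filterlim_C_iff. intros eps Heps.
  destruct (proj1 (filterlim_C_iff _ _) H eps Heps) as [N HN].
  exists (S N). intros [|n] Hn; [lia|].
  rewrite q_nest_shift. apply HN. lia.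
Qed.

(** Limits in [C] are unique, so the description operator in [beta] picks [b]. *)
Lemma is_nest_limit_beta (lambda mu s b : C) :
  is_nest_limit lambda mu s b -> beta lambda mu s = b.
Proof.
  intros Hb. unfold beta.
  apply (iota_unique (V := C_CompleteNormedModule)); [|exact Hb].
  intros y Hy.
  exact (filterlim_locally_unique (V := C_NormedModule) _ _ _ (Hy 0) (Hb 0)).
Qed.

Lemma half_pow_small (eps : R) :
  (0 < eps)%R -> exists N : nat, forall n, (N <= n)%nat -> ((/ 2) ^ n < eps)%R.
Proof.
  intros Heps.
  destruct (pow_lt_1_zero (/ 2) ltac:(rewrite Rabs_pos_eq; lra) eps Heps) as [N HN].
  exists N. intros n Hn. specialize (HN n Hn).
  rewrite Rabs_pos_eq in HN; [exact HN|]. apply pow_le; lra.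
Qed.

(** The first map applied has the largest index, so for [n <= m] the map
    [q_nest m] sends the unit disc into the image of the disc under [q_nest n].
    When every [q_j] halves distances in the disc, that image has diameter at
    most [2 * 2^-n], and these nested images shrink to one point. *)
Section Contraction.

Variables lambda mu s : C.

Hypothesis q_disc : forall (j : nat) (x : C),
  (1 <= j)%nat -> (Cmod x <= 1)%R -> (Cmod (q lambda mu j s x) <= 1)%R.

Hypothesis q_contracts : forall (j : nat) (x y : C),
  (1 <= j)%nat -> (Cmod x <= 1)%R -> (Cmod y <= 1)%R ->
  (Cmod (q lambda mu j s x - q lambda mu j s y) <= / 2 * Cmod (x - y))%R.

Hypothesis q_eventually_disc : forall z : C,
  exists N : nat, forall j : nat, (N <= j)%nat -> (Cmod (q lambda mu j s z) <= 1)%R.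

Lemma q_nest_lipschitz (n : nat) (x y : C) :
  (Cmod x <= 1)%R -> (Cmod y <= 1)%R ->
  (Cmod (q_nest lambda mu s n x - q_nest lambda mu s n y)
   <= (/ 2) ^ n * Cmod (x - y))%R.
Proof.
  revert x y. induction n as [|n IH]; intros x y Hx Hy; simpl; [lra|].
  eapply Rle_trans; [apply IH; apply q_disc; (lia || assumption)|].
  assert (H := q_contracts (S n) x y ltac:(lia) Hx Hy).
  assert (H2 : (0 < (/ 2) ^ n)%R) by (apply pow_lt; lra).
  nra.
Qed.

Lemma q_nest_factor (n m : nat) (z : C) :
  (n <= m)%nat -> (Cmod z <= 1)%R ->
  exists x : C, (Cmod x <= 1)%R /\ q_nest lambda mu s m z = q_nest lambda mu s n x.
Proof.
  intros Hnm. revert z. induction Hnm as [|m Hnm IH]; intros z Hz.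
  - now exists z.
  - apply (IH (q lambda mu (S m) s z)). apply q_disc; [lia|exact Hz].
Qed.

Lemma q_nest_close (n m : nat) (x y : C) :
  (n <= m)%nat -> (Cmod x <= 1)%R -> (Cmod y <= 1)%R ->
  (Cmod (q_nest lambda mu s m x - q_nest lambda mu s n y) <= 2 * (/ 2) ^ n)%R.
Proof.
  intros Hnm Hx Hy.
  destruct (q_nest_factor n m x Hnm Hx) as [x' [Hx' ->]].
  eapply Rle_trans; [now apply q_nest_lipschitz|].
  assert (H := Cmod_triangle x' (- y)). rewrite Cmod_opp in H.
  fold (Cminus x' y) in H.
  assert (H2 : (0 < (/ 2) ^ n)%R) by (apply pow_lt; lra).
  nra.
Qed.

Lemma contraction_nest_limit : exists b : C, is_nest_limit lambda mu s b.
Proof.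
  assert (H0 : (Cmod 0 <= 1)%R) by (rewrite Cmod_0; lra).
  assert (Hcv : exists b : C,
    filterlim (fun n => q_nest lambda mu s n 0) eventually (locally b)).
  { apply (filterlim_locally_cauchy (U := C_CompleteNormedModule)).
    intros eps.
    destruct (half_pow_small (eps / 4)) as [N HN];
      [generalize (cond_pos eps); lra|].
    exists (fun n => (N <= n)%nat). split; [now exists N|].
    intros m n Hm Hn. apply C_NormedModule_mixin_compat1.
    assert (Hm' := q_nest_close N m 0 0 Hm H0 H0).
    assert (Hn' := q_nest_close N n 0 0 Hn H0 H0).
    specialize (HN N (le_n N)).
    change (Cmod (q_nest lambda mu s n 0 - q_nest lambda mu s m 0) < eps)%R.
    set (w := q_nest lambda mu s N 0) in *.
    replace (q_nest lambda mu s n 0 - q_nest lambda mu s m 0)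
      with ((q_nest lambda mu s n 0 - w) + - (q_nest lambda mu s m 0 - w)) by ring.
    eapply Rle_lt_trans; [apply Cmod_triangle|]. rewrite Cmod_opp. lra. }
  destruct Hcv as [b Hb]. exists b. intros z.
  (* Once [q_{n+1}] has sent [z] into the disc, the outer [n] maps bring its
     orbit and that of [0] together. *)
  apply filterlim_C_iff. intros eps Heps.
  destruct (proj1 (filterlim_C_iff _ _) Hb (eps / 2)%R) as [N1 HN1]; [lra|].
  destruct (half_pow_small (eps / 4)) as [N2 HN2]; [lra|].
  destruct (q_eventually_disc z) as [N3 HN3].
  exists (S (N1 + N2 + N3)). intros [|n] Hn; [lia|].
  specialize (HN1 n ltac:(lia)). specialize (HN2 n ltac:(lia)).
  specialize (HN3 (S n) ltac:(lia)).
  assert (H := q_nest_close n n _ 0 (le_n n) HN3 H0).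
  change (Cmod (q_nest lambda mu s n (q lambda mu (S n) s z) - b) < eps)%R.
  set (w := q_nest lambda mu s n 0) in *.
  replace (q_nest lambda mu s n (q lambda mu (S n) s z) - b)
    with ((q_nest lambda mu s n (q lambda mu (S n) s z) - w) + (w - b)) by ring.
  eapply Rle_lt_trans; [apply Cmod_triangle|]. lra.
Qed.

End Contraction.

(** Moving [s] far to the left makes the denominators of all the [q_j] large at
    once, and there the nested maps contract; the functional equation carries
    the limit back to [s] in finitely many steps. *)
Lemma ex_nest_limit (lambda mu s : C) :
  (0 < Re lambda)%R -> exists b : C, is_nest_limit lambda mu s b.
Proof.
  intros hlambda.
  (* Dividing by [K] makes both the size of [q_j] on the unit disc at most [1]
     and its Lipschitz constant there at most [1 / 2]. *)
  set (K := (exp (Cmod mu) + 4 * Cmod mu * exp (3 * Cmod mu))%R).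
  destruct (q_denominator_large lambda s hlambda K) as [N HN].
  assert (Hmu := Cmod_ge_0 mu).
  assert (He1 := exp_pos (Cmod mu)). assert (He3 := exp_pos (3 * Cmod mu)).
  assert (HK1 : (exp (Cmod mu) <= K)%R) by (unfold K; nra).
  assert (HK2 : (4 * Cmod mu * exp (3 * Cmod mu) <= K)%R) by (unfold K; lra).
  assert (Hinv : forall (d : C) (A : R),
    (0 < A)%R -> (A <= Cmod d)%R -> (A * Cmod (/ d) <= 1)%R).
  { intros d A HA Hd.
    assert (Hd0 : (0 < Cmod d)%R) by lra.
    rewrite Cmod_inv by now apply Cmod_gt_0.
    apply (Rmult_le_reg_r (Cmod d)); [lra|].
    rewrite Rmult_assoc, Rinv_l; lra. }
  assert (Hfar : forall j, (1 <= j)%nat ->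
    (K * Cmod (/ (1 + Cexp (lambda * (INR j - (s - INR N))))) <= 1)%R).
  { intros j Hj. apply Hinv; [lra|].
    replace (INR j - (s - INR N)) with (INR (j + N) - s)
      by (rewrite plus_INR, RtoC_plus; ring).
    apply HN. lia. }
  assert (Hbase : exists b, is_nest_limit lambda mu (s - INR N) b).
  { apply contraction_nest_limit.
    - intros j x Hj Hx.
      eapply Rle_trans; [apply (Cmod_q_le _ _ _ _ _ 1 Hx)|].
      eapply Rle_trans; [|exact (Hfar j Hj)].
      rewrite Rmult_1_r. apply Rmult_le_compat_r; [apply Cmod_ge_0|exact HK1].
    - intros j x y Hj Hx Hy.
      eapply Rle_trans; [apply (q_lipschitz _ _ _ _ _ _ 1 Hx Hy)|].
      apply Rmult_le_compat_r; [apply Cmod_ge_0|].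
      rewrite Rmult_1_r. specialize (Hfar j Hj).
      set (d := Cmod (/ (1 + Cexp (lambda * (INR j - (s - INR N)))))) in *.
      assert (Hd : (0 <= d)%R) by apply Cmod_ge_0.
      assert (4 * Cmod mu * exp (3 * Cmod mu) * d <= K * d)%R
        by now apply Rmult_le_compat_r.
      lra.
    - intros z.
      destruct (q_denominator_large lambda (s - INR N) hlambda
                  (exp (Cmod mu * Cmod z))) as [M HM].
      exists M. intros j Hj.
      eapply Rle_trans; [apply (Cmod_q_le _ _ _ _ _ (Cmod z)); lra|].
      apply Hinv; [apply exp_pos|]. now apply HM. }
  clear - Hbase. revert s Hbase. induction N as [|N IH]; intros s [b Hb].
  - exists b. replace s with (s - INR 0) by (simpl; ring). exact Hb.
  - apply IH. exists (q lambda mu 1 (s - INR (S N) + 1) b).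
    replace (s - INR N) with (s - INR (S N) + 1)
      by (rewrite S_INR, RtoC_plus; ring).
    now apply is_nest_limit_succ.
Qed.

(** The functional equation: the limit at [s + 1] is [q_1 (s + 1, .)] of the
    limit at [s], and [lambda (1 - (s + 1)) = - lambda s]. *)
Lemma beta_succ (lambda mu s : C) :
  (0 < Re lambda)%R ->
  beta lambda mu (s + 1) =
  Cexp (mu * beta lambda mu s) / (1 + Cexp (- (lambda * s))).
Proof.
  intros hlambda. destruct (ex_nest_limit lambda mu s hlambda) as [b Hb].
  rewrite (is_nest_limit_beta _ _ _ _ Hb).
  rewrite (is_nest_limit_beta _ _ _ _ (is_nest_limit_succ _ _ _ _ Hb)).
  unfold q. do 3 f_equal. simpl. ring.
Qed.

(** * The principal logarithm *)

Lemma Re_div_Cmod_bound (z : C) : z <> 0 -> (-1 <= Re z / Cmod z <= 1)%R.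
Proof.
  intros Hz. apply Cmod_gt_0 in Hz.
  assert (H := proj1 (Rabs_le_between _ _) (re_le_Cmod z)).
  split.
  - apply Rle_div_r; [exact Hz|lra].
  - apply Rle_div_l; [exact Hz|lra].
Qed.

Lemma cos_Carg (z : C) : z <> 0 -> cos (Carg z) = (Re z / Cmod z)%R.
Proof.
  intros Hz. unfold Carg.
  destruct (Rlt_dec (Im z) 0); rewrite ?cos_neg; now apply cos_acos, Re_div_Cmod_bound.
Qed.

Lemma sqrt_1_minus_cos2 (z : C) :
  z <> 0 -> sqrt (1 - (Re z / Cmod z)²) = (Rabs (Im z) / Cmod z)%R.
Proof.
  intros Hz. apply Cmod_gt_0 in Hz.
  replace (1 - (Re z / Cmod z)²)%R with ((Im z / Cmod z)²).
  - rewrite sqrt_Rsqr_abs. unfold Rdiv. rewrite Rabs_mult. f_equal.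
    apply Rabs_pos_eq. left. now apply Rinv_0_lt_compat.
  - assert (H := Cmod2_alt z). unfold Rsqr.
    apply (Rmult_eq_reg_r (Cmod z ^ 2)); [|apply pow_nonzero; lra].
    transitivity (Im z ^ 2)%R; [field; lra|].
    transitivity (Cmod z ^ 2 - Re z ^ 2)%R; [lra|field; lra].
Qed.

Lemma sin_Carg (z : C) : z <> 0 -> sin (Carg z) = (Im z / Cmod z)%R.
Proof.
  intros Hz. unfold Carg.
  assert (Hs : sin (acos (Re z / Cmod z)) = (Rabs (Im z) / Cmod z)%R).
  { rewrite sin_acos by now apply Re_div_Cmod_bound. now apply sqrt_1_minus_cos2. }
  destruct (Rlt_dec (Im z) 0) as [Him|Him].
  - rewrite sin_neg, Hs, Rabs_left by exact Him. unfold Rdiv. ring.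
  - rewrite Hs, Rabs_pos_eq by lra. reflexivity.
Qed.

Lemma Cexp_Cln (z : C) : z <> 0 -> Cexp (Cln z) = z.
Proof.
  intros Hz. unfold Cexp, Cln; cbn [Re Im fst snd].
  rewrite cos_Carg, sin_Carg by exact Hz.
  apply Cmod_gt_0 in Hz. rewrite exp_ln by exact Hz.
  destruct z as [x y]; simpl. f_equal; field; lra.
Qed.

Lemma atan_le (t : R) : (0 <= t)%R -> (atan t <= t)%R.
Proof.
  intros Ht.
  destruct (MVT_gen atan 0 t (fun x => / (1 + x²))%R) as [c [_ Hc]].
  - intros x _. apply is_derive_atan.
  - intros x _. apply derivable_continuous_pt, derivable_pt_atan.
  - rewrite atan_0, !Rminus_0_r in Hc. rewrite Hc.
    assert (H : (/ (1 + c²) <= / 1)%R)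
      by (apply Rinv_le_contravar; generalize (Rle_0_sqr c); lra).
    rewrite Rinv_1 in H. nra.
Qed.

(** In the right half-plane [tan (Carg z) = Im z / Re z]. *)
Lemma Carg_bound (z : C) :
  (0 < Re z)%R -> (Rabs (Carg z) <= Rabs (Im z) / Re z)%R.
Proof.
  intros Hre.
  assert (Hz : z <> 0) by (intros ->; simpl in Hre; lra).
  assert (Hm := proj1 (Cmod_gt_0 z) Hz).
  replace (Rabs (Carg z)) with (acos (Re z / Cmod z)).
  - rewrite acos_atan by now apply Rdiv_lt_0_compat.
    rewrite sqrt_1_minus_cos2 by exact Hz.
    replace (Rabs (Im z) / Cmod z / (Re z / Cmod z))%R
      with (Rabs (Im z) / Re z)%R by (field; lra).
    apply atan_le. apply Rdiv_le_0_compat; [apply Rabs_pos|exact Hre].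
  - assert (H := acos_bound (Re z / Cmod z)). unfold Carg.
    destruct (Rlt_dec (Im z) 0); rewrite ?Rabs_Ropp, Rabs_pos_eq; lra.
Qed.

Lemma ln_le_minus_1 (t : R) : (0 < t)%R -> (ln t <= t - 1)%R.
Proof.
  intros Ht. assert (H := exp_ineq1_le (ln t)). rewrite exp_ln in H; lra.
Qed.

(** Both sides come from [ln t <= t - 1], applied to [t] and to [1 / t]. *)
Lemma Rabs_ln_bound (t : R) : (/ 2 <= t)%R -> (Rabs (ln t) <= 2 * Rabs (t - 1))%R.
Proof.
  intros Ht.
  assert (H1 := ln_le_minus_1 t ltac:(lra)).
  assert (Hi : (0 < / t)%R) by (apply Rinv_0_lt_compat; lra).
  assert (H2 := ln_le_minus_1 (/ t) Hi).
  rewrite ln_Rinv in H2 by lra.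
  assert (H3 : (/ t <= 2)%R).
  { rewrite <- (Rinv_inv 2). apply Rinv_le_contravar; lra. }
  assert (H4 : (/ t - 1 = / t * (1 - t))%R) by (field; lra).
  rewrite H4 in H2.
  unfold Rabs; destruct (Rcase_abs (ln t)), (Rcase_abs (t - 1)); nra.
Qed.

(** On [|x| <= 1 / 2] the point [1 + x] stays at real part at least [1 / 2] and at
    distance at most [|x|] from [1], so that both its log-modulus and its
    argument are [O(x)]. *)
Lemma Cmod_Cln_1_plus (x : C) :
  (Cmod x <= / 2)%R -> (Cmod (Cln (1 + x)) <= 4 * Cmod x)%R.
Proof.
  intros Hx.
  assert (Hre := re_le_Cmod x). assert (Him := Im_le_Cmod x).
  assert (Hre' := proj1 (Rabs_le_between _ _) Hre).
  assert (HRe : Re (1 + x) = (1 + Re x)%R) by reflexivity.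
  assert (HIm : Im (1 + x) = Im x) by (destruct x; simpl; ring).
  assert (Ht := Re_le (1 + x)). rewrite HRe in Ht.
  assert (Hdist : (Rabs (Cmod (1 + x) - 1) <= Cmod x)%R).
  { assert (H1 := Cmod_triangle 1 x). assert (H2 := Cmod_minus_le 1 (- x)).
    rewrite Cmod_opp in H2. replace (1 - - x) with (1 + x) in H2 by ring.
    rewrite Cmod_1 in *. apply Rabs_le. lra. }
  assert (Hln := Rabs_ln_bound (Cmod (1 + x)) ltac:(lra)).
  assert (Harg := Carg_bound (1 + x) ltac:(rewrite HRe; lra)).
  rewrite HRe, HIm in Harg.
  assert (H2 : (Rabs (Im x) / (1 + Re x) <= 2 * Cmod x)%R).
  { apply Rle_div_l; [lra|]. generalize (Cmod_ge_0 x); nra. }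
  (* The two components of the logarithm contribute [2 |x|] each. *)
  replace (Cln (1 + x))
    with (RtoC (ln (Cmod (1 + x))) + RtoC (Carg (1 + x)) * Ci).
  - eapply Rle_trans; [apply Cmod_triangle|].
    rewrite Cmod_mult, Cmod_Ci, !Cmod_R. lra.
  - unfold Cln, RtoC, Ci, Cplus, Cmult; simpl. f_equal; ring.
Qed.

(** * The asymptotic equation *)

(** [Re z = |z| cos (Carg z)], and the cosine decreases with the absolute value
    of the argument. *)
Lemma Re_ge_in_sector (z : C) (theta : R) :
  z <> 0 -> (theta <= PI)%R -> (Rabs (Carg z) <= theta)%R ->
  (cos theta * Cmod z <= Re z)%R.
Proof.
  intros Hz Hth Harg.
  assert (Hm := proj1 (Cmod_gt_0 z) Hz).
  assert (H0 := Rabs_pos (Carg z)).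
  assert (Hcos : (cos theta <= cos (Rabs (Carg z)))%R)
    by (apply cos_decr_1; lra).
  assert (Habs : cos (Rabs (Carg z)) = cos (Carg z)).
  { unfold Rabs; destruct (Rcase_abs (Carg z)); [apply cos_neg|reflexivity]. }
  rewrite Habs, cos_Carg in Hcos by exact Hz.
  now apply Rle_div_r.
Qed.

(** The value [acos 0] of [Carg 0] keeps the origin out of the open sector. *)
Lemma Re_pos_in_sector (z : C) : (Rabs (Carg z) < PI / 2)%R -> (0 < Re z)%R.
Proof.
  intros Harg.
  assert (HPI := PI_RGT_0).
  assert (Hz : z <> 0).
  { intros ->. revert Harg. unfold Carg; simpl.
    destruct (Rlt_dec 0 0) as [H|_]; [lra|].
    unfold Rdiv. rewrite Rmult_0_l, acos_0, Rabs_pos_eq; lra. }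
  assert (H := Re_ge_in_sector z (Rabs (Carg z)) Hz ltac:(lra) (Rle_refl _)).
  assert (H1 := Rabs_pos (Carg z)).
  assert (H2 : (0 < cos (Rabs (Carg z)))%R) by (apply cos_gt_0; lra).
  apply Cmod_gt_0 in Hz. nra.
Qed.

Theorem theorem1p3p2 (lambda mu : C) (hmu : mu <> RtoC 0) (hlambda : (0 < Re lambda)%R) :
  exists lnbeta_succ : C -> C,
    (forall s : C, beta_dom lambda s -> (Rabs (Carg (lambda * s)%C) < PI / 2)%R ->
       is_ln_beta_succ lambda mu s (lnbeta_succ s)) /\
    (forall theta : R, (theta < PI / 2)%R ->
       is_bigO
         (within (fun s => beta_dom lambda s /\
                           (Rabs (Carg (lambda * s)%C) <= theta)%R) C_infty)
         (fun s => lnbeta_succ s / mu - beta lambda mu s)%C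
         (fun s => Cexp (- (lambda * s)))%C).
Proof.
  exists (fun s => mu * beta lambda mu s - Cln (1 + Cexp (- (lambda * s)))).
  split.
  - intros s _ Hs. split; [|reflexivity].
    apply Re_pos_in_sector in Hs.
    assert (H1 : 1 + Cexp (- (lambda * s)) <> 0).
    { intros H0.
      (* A zero would force [|exp (- lambda s)| = 1], but this modulus is
         [exp (- Re (lambda s)) < 1]. *)
      assert (H : Cexp (- (lambda * s)) = - (1)).
      { replace (Cexp (- (lambda * s)))
          with ((1 + Cexp (- (lambda * s))) - 1) by ring.
        rewrite H0. ring. }
      apply (f_equal Cmod) in H.
      rewrite Cmod_opp, Cmod_1, Cmod_Cexp, <- exp_0 in H.
      apply exp_inv in H.
      change (Re (- (lambda * s))) with (- Re (lambda * s))%R in H. lra. }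
    rewrite Cexp_minus, (Cexp_Cln _ H1). symmetry. now apply beta_succ.
  - intros theta Htheta.
    exists (4 / Cmod mu)%R.
    assert (HPI := PI_RGT_0).
    assert (Hmu := proj1 (Cmod_gt_0 mu) hmu).
    assert (Hl0 : lambda <> 0) by (intros ->; simpl in hlambda; lra).
    assert (Hl := proj1 (Cmod_gt_0 lambda) Hl0).
    (* Beyond this radius [Re (lambda s) >= |lambda s| cos theta >= 1] in the
       sector, hence [|exp (- lambda s)| <= 1 / 2]. *)
    exists (Rmax 0 (/ (cos theta * Cmod lambda))).
    intros s HM [_ Harg].
    assert (Hth0 : (0 <= theta)%R) by (generalize (Rabs_pos (Carg (lambda * s))); lra).
    assert (Hcos : (0 < cos theta)%R) by (apply cos_gt_0; lra).
    assert (HM0 := Rmax_l 0 (/ (cos theta * Cmod lambda))).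
    assert (HM1 := Rmax_r 0 (/ (cos theta * Cmod lambda))).
    assert (Hs : s <> 0) by (apply Cmod_gt_0; lra).
    assert (Hre := Re_ge_in_sector (lambda * s) theta
                     (Cmult_neq_0 _ _ Hl0 Hs) ltac:(lra) Harg).
    rewrite Cmod_mult in Hre.
    assert (Hcl : (0 < cos theta * Cmod lambda)%R) by now apply Rmult_lt_0_compat.
    assert (H1 : (1 <= Re (lambda * s))%R).
    { assert (Hinv : (cos theta * Cmod lambda * / (cos theta * Cmod lambda) = 1)%R)
        by (apply Rinv_r; lra).
      nra. }
    assert (Hsmall : (Cmod (Cexp (- (lambda * s))) <= / 2)%R).
    { rewrite Cmod_Cexp.
      change (Re (- (lambda * s))) with (- Re (lambda * s))%R.
      rewrite exp_Ropp. apply Rinv_le_contravar; [lra|].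
      generalize (exp_ineq1_le (Re (lambda * s))); lra. }
    set (e := Cexp (- (lambda * s))) in *.
    replace ((mu * beta lambda mu s - Cln (1 + e)) / mu - beta lambda mu s)
      with (- (Cln (1 + e) / mu)) by (field; exact hmu).
    rewrite Cmod_opp, Cmod_div by exact hmu.
    assert (H2 := Cmod_Cln_1_plus e Hsmall).
    replace (4 / Cmod mu * Cmod e)%R with (4 * Cmod e / Cmod mu)%R by (field; lra).
    apply Rmult_le_compat_r; [|exact H2].
    left. now apply Rinv_0_lt_compat.
Qed.
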